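(* Let $n\ge1$ be an integer, let $B_0\subset\mathbb{R}^2$ be a box, let $f\colon\mathbb{R}^2\to\mathbb{R}$ be a function all of whose partial derivatives up to order $3n+3$ exist and are bounded on $B_0$, and for all integers $i,j\ge0$ with $i+j\in\{n,n+1\}$ let $\Box f^{(3i,3j)}$ be a range function for $f^{(3i,3j)}$ that is bounded over $B_0$. Then the recursive Lagrange form $\Box^{\mathrm{L}}_{3,n}f$ of order $3$ and level $n$ (defined in the context) has cubic convergence on $B_0$; that is, there exists a constant $C>0$, which may depend on $f$ and $B_0$ (as well as on $n$ and the given range functions) but not on $B$, such that $$d_{\mathrm{H}}\bigl(f(B),\,\Box^{\mathrm{L}}_{3,n}f(B)\bigr)\le C\,w(B)^3$$ for all squares $B\subseteq B_0$ of positive radius.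
   Context: A box is a closed axis-aligned rectangle $B=[a_x,b_x]\times[a_y,b_y]\subset\mathbb{R}^2$; its midpoint is $\boldsymbol m=(m_x,m_y)=(a_x+b_x,a_y+b_y)/2$, its radii are $(r_x,r_y)=(b_x-a_x,b_y-a_y)/2$, and its width is $w(B)=2\max(r_x,r_y)$. A square is a box with $r_x=r_y$, and this common value is called its radius $r$. For a closed interval $I=[a,b]$, its magnitude is $|I|=\max\{|a|,|b|\}$. Intervals are added and scaled by interval arithmetic: $[a,b]+[c,d]=[a+c,b+d]$, and $[-1,1]\rho=[-\rho,\rho]$ for $\rho\ge 0$. The Hausdorff distance is $d_{\mathrm{H}}([a,b],[a',b'])=\max\{|a-a'|,|b-b'|\}$. For a function $g$ and a set $S$, $g(S)=\{g(x):x\in S\}$ is the exact range. A range function for $g\colon\mathbb{R}^2\to\mathbb{R}$ is a map $\Box g$ from boxes to closed bounded intervals with $\Box g(B)\supseteq g(B)$ for every box $B$ on which $g$ is defined (in particular for all $B\subseteq B_0$). It is bounded over $B_0$ if there is a constant $K$ with $|\Box g(B)|\le K$ for all boxes $B\subseteq B_0$. Partial derivatives are denoted by $f^{(i,j)}=\frac{\partial^{i+j}}{\partial x^i\partial y^j}f$. For $0\le k\le n$ define the (Delannoy) coefficients $$\begin{bmatrix}n\\ k\end{bmatrix}=\sum_{i=0}^k\binom ki\binom{n-k}i2^i.$$ Let $B$ be a square with midpoint $\boldsymbol m$ and radius $r>0$, and let $\Omega_{\mathrm L}=\frac{\sqrt3}{27}r^3$. For $i,j\ge0$ let $L_{i,j}$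 be the unique biquadratic polynomial (degree at most $2$ in $x$ and at most $2$ in $y$) that interpolates $f^{(3i,3j)}$ at the nine points of the grid $\{m_x-r,m_x,m_x+r\}\times\{m_y-r,m_y,m_y+r\}$. Split $L_{i,j}=T^{\mathrm L}_{i,j}+R^{\mathrm L}_{i,j}$, where, with $h_x=x-m_x$ and $h_y=y-m_y$, $$T^{\mathrm L}_{i,j}(x,y)=L_{i,j}(\boldsymbol m)+h_xL_{i,j}^{(1,0)}(\boldsymbol m)+h_yL_{i,j}^{(0,1)}(\boldsymbol m)+\tfrac12h_x^2L_{i,j}^{(2,0)}(\boldsymbol m)+h_xh_yL_{i,j}^{(1,1)}(\boldsymbol m)+\tfrac12h_y^2L_{i,j}^{(0,2)}(\boldsymbol m)$$ is the second degree Taylor polynomial of $L_{i,j}$ about $\boldsymbol m$ and $$R^{\mathrm L}_{i,j}(x,y)=\tfrac12h_x^2h_yL_{i,j}^{(2,1)}(\boldsymbol m)+\tfrac12h_xh_y^2L_{i,j}^{(1,2)}(\boldsymbol m)+\tfrac14h_x^2h_y^2L_{i,j}^{(2,2)}(\boldsymbol m).$$ The recursive Lagrange form of order $3$ and level $n$ is $$\Box^{\mathrm L}_{3,n}f(B)=T^{\mathrm L}_{0,0}(B)+R^{\mathrm L}_{0,0}(B)+[-1,1]\,U_{3,n},\qquad U_{3,n}=\sum_{k=1}^{n+1}u_k\,\Omega_{\mathrm L}^k,$$ where $$u_k=\sum_{j=0}^k\begin{bmatrix}k\\ j\end{bmatrix}\bigl|T^{\mathrm L}_{k-j,j}(B)+R^{\mathrm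 L}_{k-j,j}(B)\bigr|\quad(k=1,\dots,n-1),$$ $$u_n=\sum_{j=0}^n\begin{bmatrix}n\\ j\end{bmatrix}\bigl|\Box f^{(3(n-j),3j)}(B)\bigr|,\qquad u_{n+1}=\sum_{j=1}^n\begin{bmatrix}n-1\\ j-1\end{bmatrix}\bigl|\Box f^{(3(n+1-j),3j)}(B)\bigr|.$$ Here $T^{\mathrm L}_{i,j}(B)$ and $R^{\mathrm L}_{i,j}(B)$ are exact ranges and sums of them are interval sums. *)

(* Defs.v *)
(* Stdlib reals and Coquelicot; only the natural-number binomial coefficient is
   taken from MathComp, because Stdlib's [C n p] is nonzero for [p > n]. *)
From Stdlib Require Import Reals Lra Arith ClassicalEpsilon.
From Coquelicot Require Import Coquelicot.
From mathcomp Require binomial.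

Open Scope R_scope.

Record interval : Type := Interval {
  lo : R;
  hi : R;
  lo_le_hi : lo <= hi
}.

Definition in_itv (z : R) (I : interval) : Prop := lo I <= z <= hi I.

Definition itv_mag (I : interval) : R := Rmax (Rabs (lo I)) (Rabs (hi I)).

Definition itv_add (I J : interval) : interval :=
  Interval (lo I + lo J) (hi I + hi J)
    (Rplus_le_compat _ _ _ _ (lo_le_hi I) (lo_le_hi J)).

Definition itv_scale (I : interval) (c : R) : interval :=
  Interval (Rmin (c * lo I) (c * hi I)) (Rmax (c * lo I) (c * hi I))
    (Rminmax _ _).

Lemma m1_le_1 : -1 <= 1.
Proof. lra. Qed.

Definition unit_itv : interval := Interval (-1) 1 m1_le_1.

Definition itv_dH (I J : interval) : R :=
  Rmax (Rabs (lo I - lo J)) (Rabs (hi I - hi J)).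

Record box : Type := Box {
  bax : R;
  bbx : R;
  bay : R;
  bby : R;
  bx_le : bax <= bbx;
  by_le : bay <= bby
}.

Definition in_box (x y : R) (B : box) : Prop :=
  bax B <= x <= bbx B /\ bay B <= y <= bby B.

Definition sub_box (B B' : box) : Prop :=
  forall x y : R, in_box x y B -> in_box x y B'.

Definition mid_x (B : box) : R := (bax B + bbx B) / 2.
Definition mid_y (B : box) : R := (bay B + bby B) / 2.
Definition rad_x (B : box) : R := (bbx B - bax B) / 2.
Definition rad_y (B : box) : R := (bby B - bay B) / 2.
Definition width (B : box) : R := 2 * Rmax (rad_x B) (rad_y B).

Definition is_square (B : box) : Prop := rad_x B = rad_y B.

(* The exact range [g(B)], regarded as an interval.  [range_itv g B] is the
   interval equal to [g(B)]; it is unspecified if [g(B)] is not a closed bounded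
   interval, which does not happen for continuous [g]. *)
Definition is_range (g : R -> R -> R) (B : box) (I : interval) : Prop :=
  forall z : R,
    in_itv z I <-> exists x y : R, in_box x y B /\ g x y = z.

Definition range_itv (g : R -> R -> R) (B : box) : interval :=
  epsilon (inhabits unit_itv) (is_range g B).

(* [ex_partial i j f x y]: the partial derivative of [f] that is [i]-fold in x
   of the [j]-fold one in y, i.e. [partial_derive i j f], exists at [(x, y)].
   [Derive] is total, so existence of the preceding derivative along a
   neighbourhood has to be required explicitly. *)
Fixpoint ex_nth_derive (n : nat) (g : R -> R) (x : R) : Prop :=
  match n with
  | O => True
  | S m => locally x (ex_nth_derive m g) /\ ex_derive (Derive_n g m) x
  end.

Fixpoint ex_partial (i j : nat) (f : R -> R -> R) (x y : R) : Prop :=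
  match i with
  | O => ex_nth_derive j (f x) y
  | S k => locally x (fun s => ex_partial k j f s y) /\
           ex_derive (fun s => partial_derive k j f s y) x
  end.

(* [D] is the domain on which [g] is defined. *)
Definition is_range_function (D : R -> R -> Prop) (g : R -> R -> R)
    (G : box -> interval) : Prop :=
  forall B : box,
    (forall x y : R, in_box x y B -> D x y) ->
    forall x y : R, in_box x y B -> in_itv (g x y) (G B).

Definition bounded_over (B0 : box) (G : box -> interval) : Prop :=
  exists K : R, forall B : box, sub_box B B0 -> itv_mag (G B) <= K.

Definition delannoy (n k : nat) : R :=
  sum_n (fun i => INR (binomial.binomial k i) *
                  INR (binomial.binomial (n - k) i) * 2 ^ i) k.

Definition biquadratic (p : R -> R -> R) : Prop :=
  exists c : nat -> nat -> R, forall x y : R,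
    p x y = sum_n (fun a => sum_n (fun b => c a b * x ^ a * y ^ b) 2) 2.

Definition interpolates_on_grid (g : R -> R -> R) (B : box)
    (p : R -> R -> R) : Prop :=
  forall x y : R,
    (x = mid_x B - rad_x B \/ x = mid_x B \/ x = mid_x B + rad_x B) ->
    (y = mid_y B - rad_y B \/ y = mid_y B \/ y = mid_y B + rad_y B) ->
    p x y = g x y.

(* The interpolant exists and is unique as soon as both radii are positive. *)
Definition lagrange (g : R -> R -> R) (B : box) : R -> R -> R :=
  epsilon (inhabits (fun _ _ : R => 0))
    (fun p => biquadratic p /\ interpolates_on_grid g B p).

Definition L_poly (f : R -> R -> R) (B : box) (i j : nat) : R -> R -> R :=
  lagrange (partial_derive (3 * i) (3 * j) f) B.

Definition T_part (L : R -> R -> R) (B : box) (x y : R) : R :=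
  let hx := x - mid_x B in
  let hy := y - mid_y B in
  let d a b := partial_derive a b L (mid_x B) (mid_y B) in
  L (mid_x B) (mid_y B) + hx * d 1%nat 0%nat + hy * d 0%nat 1%nat
  + 1 / 2 * hx ^ 2 * d 2%nat 0%nat + hx * hy * d 1%nat 1%nat
  + 1 / 2 * hy ^ 2 * d 0%nat 2%nat.

Definition R_part (L : R -> R -> R) (B : box) (x y : R) : R :=
  let hx := x - mid_x B in
  let hy := y - mid_y B in
  let d a b := partial_derive a b L (mid_x B) (mid_y B) in
  1 / 2 * hx ^ 2 * hy * d 2%nat 1%nat + 1 / 2 * hx * hy ^ 2 * d 1%nat 2%nat
  + 1 / 4 * hx ^ 2 * hy ^ 2 * d 2%nat 2%nat.

(* Sum of two separate exact ranges, not the range of the sum. *)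
Definition TR_itv (f : R -> R -> R) (B : box) (i j : nat) : interval :=
  itv_add (range_itv (T_part (L_poly f B i j) B) B)
          (range_itv (R_part (L_poly f B i j) B) B).

Definition Omega_L (B : box) : R := sqrt 3 / 27 * rad_x B ^ 3.

(* [F i j] stands for the range function of the derivative of order
   [(3 i, 3 j)] of [f]. *)
Definition u_coef (n : nat) (f : R -> R -> R) (F : nat -> nat -> box -> interval)
    (B : box) (k : nat) : R :=
  if (k <? n)%nat then
    sum_n (fun j => delannoy k j * itv_mag (TR_itv f B (k - j) j)) k
  else if (k =? n)%nat then
    sum_n (fun j => delannoy n j * itv_mag (F (n - j)%nat j B)) n
  else
    sum_n_m (fun j => delannoy (n - 1) (j - 1) *
                      itv_mag (F (n + 1 - j)%nat j B)) 1 n.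

Definition U_bound (n : nat) (f : R -> R -> R)
    (F : nat -> nat -> box -> interval) (B : box) : R :=
  sum_n_m (fun k => u_coef n f F B k * Omega_L B ^ k) 1 (n + 1).

Definition lagrange_form (n : nat) (f : R -> R -> R)
    (F : nat -> nat -> box -> interval) (B : box) : interval :=
  itv_add (TR_itv f B 0 0) (itv_scale unit_itv (U_bound n f F B)).

(* Main.v *)
Require Import Defs.
From Stdlib Require Import Reals Arith Factorial Lra Lia ClassicalEpsilon.
From Coquelicot Require Import Coquelicot.
Open Scope R_scope.

(** The form [T(B) + R(B) + [-1, 1] U] converges cubically because [T] alone is
    within [O(r ^ 3)] of [f] on [B], while [R] and [U] are themselves
    [O(r ^ 3)]: the ends of the exact range move by no more than the uniform
    distance of the functions ([range_itv_close]), and the two other summands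
    move them by no more than their magnitudes.

    In the variables [s = (x - m_x) / r] and [t = (y - m_y) / r], which lie in
    [[-1, 1]], the coefficient of [s ^ a * t ^ b] in the interpolant is a tensor
    product of three-point differences of the grid values ([grid_coef],
    [T_part_lagrange], [R_part_lagrange]).  This yields three facts.

    - The coefficients are bounded by the values of the interpolated function.
      So all [u_k] are bounded, and since [U] carries only positive powers of
      [Omega_L], it is cubic ([U_bound_cubic]).

    - The coefficients [(2, 1)], [(1, 2)] and [(2, 2)] of [R] are differences of
      total order at least 3, hence of size [r ^ 3] by the derivatives [(2, 1)]
      and [(1, 2)] of [f] ([grid_coef_order], [R_part_small]).

    - Quadratic interpolation in one variable has an error of size [r ^ 3] times
      a bound on the third derivative, and the two-variable interpolant is an
      iterated one-variable interpolant.  So [f - T - R] is cubic by the pure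
      third derivatives ([quad_interp_error], [T_part_close]).

    The derivatives are only known at the points of a closed box, and in a fixed
    order of differentiation.  The Taylor estimates are therefore derived from
    the mean value theorem on closed intervals ([mean_value_growth]), and finite
    differences in [y] are applied last. *)

(** * Exact ranges of Lipschitz functions *)

(** A Lipschitz condition passes directly from a function of two variables to
    its maximum over one of them, which reduces extreme values on a box to
    extreme values on an interval. *)
Definition lipschitz_on (B : box) (g : R -> R -> R) : Prop :=
  exists K : R, 0 <= K /\
    forall x y x' y' : R, in_box x y B -> in_box x' y' B ->
      Rabs (g x y - g x' y') <= K * (Rabs (x - x') + Rabs (y - y')).

(** Composing with the retraction onto [[a, b]] turns a function controlled
    only on the interval into one that is continuous on the whole line, as the
    one-variable extreme and intermediate value theorems require. *)
Definition clamp (a b t : R) : R := Rmax a (Rmin b t).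

Lemma clamp_in (a b t : R) : a <= b -> a <= clamp a b t <= b.
Proof. intros; unfold clamp, Rmax, Rmin; repeat destruct Rle_dec; lra. Qed.

Lemma clamp_id (a b t : R) : a <= t <= b -> clamp a b t = t.
Proof. intros; unfold clamp, Rmax, Rmin; repeat destruct Rle_dec; lra. Qed.

Lemma clamp_contracts (a b t u : R) :
  a <= b -> Rabs (clamp a b t - clamp a b u) <= Rabs (t - u).
Proof.
  intros; unfold clamp, Rmax, Rmin, Rabs.
  repeat destruct Rle_dec; repeat destruct Rcase_abs; lra.
Qed.

Lemma continuity_clamped (a b K : R) (phi : R -> R) :
  a <= b -> 0 <= K ->
  (forall t u, a <= t <= b -> a <= u <= b ->
     Rabs (phi t - phi u) <= K * Rabs (t - u)) ->
  continuity (fun t => phi (clamp a b t)).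
Proof.
  intros Hab HK H t eps Heps.
  exists (eps / (K + 1)); split.
  - apply Rdiv_lt_0_compat; lra.
  - intros u [_ Hu]; simpl in *; unfold R_dist in *.
    apply Rle_lt_trans with (K * Rabs (u - t)).
    + eapply Rle_trans; [apply H; now apply clamp_in |].
      apply Rmult_le_compat_l; [exact HK | now apply clamp_contracts].
    + assert (0 <= Rabs (u - t)) by apply Rabs_pos.
      assert (Rabs (u - t) * (K + 1) < eps).
      { apply (Rmult_lt_compat_r (K + 1)) in Hu; [|lra].
        unfold Rdiv in Hu; rewrite Rmult_assoc, Rinv_l, Rmult_1_r in Hu; lra. }
      nra.
Qed.

Lemma lipschitz_max_1d (a b K : R) (phi : R -> R) :
  a <= b -> 0 <= K ->
  (forall t u, a <= t <= b -> a <= u <= b ->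
     Rabs (phi t - phi u) <= K * Rabs (t - u)) ->
  exists t, a <= t <= b /\ forall u, a <= u <= b -> phi u <= phi t.
Proof.
  intros Hab HK H.
  destruct (continuity_ab_maj (fun t => phi (clamp a b t)) a b Hab)
    as [t [Ht Hin]].
  { intros; now apply (continuity_clamped a b K). }
  exists t; split; [exact Hin |].
  intros u Hu; specialize (Ht u Hu); simpl in Ht.
  rewrite !clamp_id in Ht by assumption; exact Ht.
Qed.

(** Two applications of the one-variable statement: maximizing over [y] leaves
    a function of [x] with the same Lipschitz constant. *)
Lemma lipschitz_max (B : box) (g : R -> R -> R) :
  lipschitz_on B g ->
  exists x y, in_box x y B /\ forall x' y', in_box x' y' B -> g x' y' <= g x y.
Proof.
  intros [K [HK H]].
  pose proof (bx_le B) as Hx; pose proof (by_le B) as Hy.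
  set (best x y := bay B <= y <= bby B /\
         forall u, bay B <= u <= bby B -> g x u <= g x y).
  set (top x := epsilon (inhabits 0) (best x)).
  assert (Hbest : forall x, bax B <= x <= bbx B -> best x (top x)).
  { intros x Hin; apply epsilon_spec.
    apply (lipschitz_max_1d _ _ K); [exact Hy | exact HK |].
    intros t u Ht Hu.
    eapply Rle_trans; [apply H; split; assumption |].
    rewrite Rminus_diag, Rabs_R0; lra. }
  assert (Hlip : forall t u, bax B <= t <= bbx B -> bax B <= u <= bbx B ->
            g t (top t) - g u (top u) <= K * Rabs (t - u)).
  { intros t u Ht Hu.
    destruct (Hbest t Ht) as [Ht1 _]; destruct (Hbest u Hu) as [_ Hu2].
    specialize (Hu2 _ Ht1).
    assert (Hd : Rabs (g t (top t) - g u (top t)) <= K * Rabs (t - u)).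
    { eapply Rle_trans; [apply H; split; assumption |].
      rewrite Rminus_diag, Rabs_R0; lra. }
    apply Rabs_le_between in Hd; lra. }
  destruct (lipschitz_max_1d (bax B) (bbx B) K (fun x => g x (top x)))
    as [x [Hin Hmax]]; try assumption.
  { intros t u Ht Hu; apply Rabs_le_between; split; [|now apply Hlip].
    specialize (Hlip u t Hu Ht); rewrite Rabs_minus_sym in Hlip; lra. }
  exists x, (top x); split.
  - split; [exact Hin | apply (Hbest x Hin)].
  - intros x' y' [Hx' Hy'].
    eapply Rle_trans; [apply (Hbest x' Hx'), Hy' | now apply Hmax].
Qed.

Lemma lipschitz_const (B : box) (c : R) : lipschitz_on B (fun _ _ => c).
Proof.
  exists 0; split; [lra |]; intros.
  rewrite Rminus_diag, Rabs_R0; lra.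
Qed.

Lemma lipschitz_x (B : box) : lipschitz_on B (fun x _ => x).
Proof.
  exists 1; split; [lra |]; intros.
  pose proof (Rabs_pos (y - y')); lra.
Qed.

Lemma lipschitz_y (B : box) : lipschitz_on B (fun _ y => y).
Proof.
  exists 1; split; [lra |]; intros.
  pose proof (Rabs_pos (x - x')); lra.
Qed.

Lemma lipschitz_plus (B : box) (g h : R -> R -> R) :
  lipschitz_on B g -> lipschitz_on B h ->
  lipschitz_on B (fun x y => g x y + h x y).
Proof.
  intros [K [HK Hg]] [M [HM Hh]]; exists (K + M); split; [lra |].
  intros x y x' y' H H'.
  specialize (Hg _ _ _ _ H H'); specialize (Hh _ _ _ _ H H').
  replace (g x y + h x y - (g x' y' + h x' y'))
    with ((g x y - g x' y') + (h x y - h x' y')) by ring.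
  eapply Rle_trans; [apply Rabs_triang | lra].
Qed.

Lemma lipschitz_bounded (B : box) (g : R -> R -> R) :
  lipschitz_on B g -> exists M, forall x y, in_box x y B -> Rabs (g x y) <= M.
Proof.
  intros [K [HK Hg]].
  exists (Rabs (g (bax B) (bay B)) +
          K * ((bbx B - bax B) + (bby B - bay B))).
  intros x y H.
  assert (H0 : in_box (bax B) (bay B) B).
  { pose proof (bx_le B); pose proof (by_le B); split; lra. }
  specialize (Hg _ _ _ _ H H0).
  replace (g x y) with (g (bax B) (bay B) + (g x y - g (bax B) (bay B))) by ring.
  eapply Rle_trans; [apply Rabs_triang |].
  apply Rplus_le_compat_l; eapply Rle_trans; [exact Hg |].
  destruct H as [Hx Hy].
  apply Rmult_le_compat_l; [exact HK |].
  rewrite !Rabs_pos_eq; lra.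
Qed.

Lemma lipschitz_mult (B : box) (g h : R -> R -> R) :
  lipschitz_on B g -> lipschitz_on B h ->
  lipschitz_on B (fun x y => g x y * h x y).
Proof.
  intros Hg Hh.
  destruct (lipschitz_bounded B g Hg) as [P HP].
  destruct (lipschitz_bounded B h Hh) as [Q HQ].
  destruct Hg as [K [HK Hg]]; destruct Hh as [M [HM Hh]].
  exists (Rabs P * M + Rabs Q * K); split.
  { pose proof (Rabs_pos P); pose proof (Rabs_pos Q); nra. }
  intros x y x' y' H H'.
  specialize (Hg _ _ _ _ H H'); specialize (Hh _ _ _ _ H H').
  specialize (HP _ _ H); specialize (HQ _ _ H').
  replace (g x y * h x y - g x' y' * h x' y')
    with (g x y * (h x y - h x' y') + h x' y' * (g x y - g x' y')) by ring.
  eapply Rle_trans; [apply Rabs_triang |]; rewrite !Rabs_mult.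
  set (d := Rabs (x - x') + Rabs (y - y')) in *.
  rewrite Rmult_plus_distr_r, !Rmult_assoc.
  pose proof (Rle_abs P); pose proof (Rle_abs Q).
  apply Rplus_le_compat; apply Rmult_le_compat;
    try apply Rabs_pos; assumption || lra.
Qed.

(** Extreme values give the two ends; values in between are taken on the
    segment that joins a minimizer to a maximizer, which lies in the box by
    convexity. *)
Lemma range_itv_spec (B : box) (g : R -> R -> R) :
  lipschitz_on B g -> is_range g B (range_itv g B).
Proof.
  intros Hg; unfold range_itv; apply epsilon_spec.
  destruct (lipschitz_max B g Hg) as [x1 [y1 [H1 Hmax]]].
  destruct (lipschitz_max B (fun x y => -1 * g x y)) as [x0 [y0 [H0 Hmin]]].
  { apply lipschitz_mult; [apply lipschitz_const | exact Hg]. }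
  assert (Hle : g x0 y0 <= g x1 y1) by now apply Hmax.
  exists (Interval (g x0 y0) (g x1 y1) Hle).
  intros z; split.
  - intros Hz; unfold in_itv in Hz; simpl in Hz.
    destruct Hg as [K [HK Hg]].
    pose (X t := x0 + t * (x1 - x0)); pose (Y t := y0 + t * (y1 - y0)).
    assert (HB : forall t, 0 <= t <= 1 -> in_box (X t) (Y t) B).
    { intros t Ht; unfold X, Y.
      destruct H0 as [H0x H0y]; destruct H1 as [H1x H1y].
      repeat split; nra. }
    assert (Hc : continuity (fun t => g (X (clamp 0 1 t)) (Y (clamp 0 1 t)))).
    { apply (continuity_clamped 0 1
               (K * (Rabs (x1 - x0) + Rabs (y1 - y0)))
               (fun t => g (X t) (Y t))).
      - lra.
      - apply Rmult_le_pos; [exact HK |].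
        pose proof (Rabs_pos (x1 - x0)); pose proof (Rabs_pos (y1 - y0)); lra.
      - intros t u Ht Hu; eapply Rle_trans; [apply Hg; now apply HB |].
        unfold X, Y.
        replace (x0 + t * (x1 - x0) - (x0 + u * (x1 - x0)))
          with ((x1 - x0) * (t - u)) by ring.
        replace (y0 + t * (y1 - y0) - (y0 + u * (y1 - y0)))
          with ((y1 - y0) * (t - u)) by ring.
        rewrite !Rabs_mult; apply Req_le; ring. }
    destruct (IVT_gen _ 0 1 z Hc) as [t [_ Ht]].
    { rewrite !clamp_id by lra; unfold X, Y.
      rewrite !Rmult_0_l, !Rmult_1_l, !Rplus_0_r.
      replace (x0 + (x1 - x0)) with x1 by ring.
      replace (y0 + (y1 - y0)) with y1 by ring.
      rewrite Rmin_left, Rmax_right; assumption. }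
    exists (X (clamp 0 1 t)), (Y (clamp 0 1 t)); split; [|exact Ht].
    apply HB, clamp_in; lra.
  - intros [x [y [H <-]]]; unfold in_itv; simpl.
    specialize (Hmax _ _ H); specialize (Hmin _ _ H); lra.
Qed.

Lemma range_itv_ends (B : box) (g : R -> R -> R) :
  lipschitz_on B g ->
  (exists x y, in_box x y B /\ g x y = lo (range_itv g B)) /\
  (exists x y, in_box x y B /\ g x y = hi (range_itv g B)) /\
  (forall x y, in_box x y B -> in_itv (g x y) (range_itv g B)).
Proof.
  intros Hg; pose proof (range_itv_spec B g Hg) as H.
  pose proof (lo_le_hi (range_itv g B)).
  repeat split; try (apply H; unfold in_itv; lra).
  all: assert (E : in_itv (g x y) (range_itv g B)) by (apply H; eauto); apply E.
Qed.

(** Passing to the range does not increase the uniform distance: each end of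
    one range is a value, and the other function comes within [eps] of it. *)
Lemma range_itv_close (B : box) (g h : R -> R -> R) (eps : R) :
  lipschitz_on B g -> lipschitz_on B h ->
  (forall x y, in_box x y B -> Rabs (g x y - h x y) <= eps) ->
  Rabs (lo (range_itv g B) - lo (range_itv h B)) <= eps /\
  Rabs (hi (range_itv g B) - hi (range_itv h B)) <= eps.
Proof.
  intros Hg Hh Hc.
  destruct (range_itv_ends B g Hg)
    as [[xg [yg [Bg Eg]]] [[ug [vg [Bg' Eg']]] Ig]].
  destruct (range_itv_ends B h Hh)
    as [[xh [yh [Bh Eh]]] [[uh [vh [Bh' Eh']]] Ih]].
  pose proof (Hc _ _ Bg) as C1; pose proof (Hc _ _ Bg') as C2.
  pose proof (Hc _ _ Bh) as C3; pose proof (Hc _ _ Bh') as C4.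
  pose proof (Ig _ _ Bh) as [I1 _]; pose proof (Ig _ _ Bh') as [_ I2].
  pose proof (Ih _ _ Bg) as [I3 _]; pose proof (Ih _ _ Bg') as [_ I4].
  apply Rabs_le_between in C1; apply Rabs_le_between in C2.
  apply Rabs_le_between in C3; apply Rabs_le_between in C4.
  split; apply Rabs_le_between; lra.
Qed.

Lemma range_itv_abs (B : box) (g : R -> R -> R) (M : R) :
  lipschitz_on B g -> (forall x y, in_box x y B -> Rabs (g x y) <= M) ->
  Rabs (lo (range_itv g B)) <= M /\ Rabs (hi (range_itv g B)) <= M.
Proof.
  intros Hg HM.
  destruct (range_itv_ends B g Hg)
    as [[x [y [H <-]]] [[u [v [H' <-]]] _]].
  split; now apply HM.
Qed.

(** * Taylor estimates on a closed interval *)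

(** The step from which all Taylor estimates follow by iteration: the mean
    value theorem raises by one the order to which [E] vanishes at [m].  The
    derivatives are asked for at the points of [[a, b]] only, and the estimate
    holds on both sides of [m]. *)
Lemma mean_value_growth (a b m K : R) (p : nat) (E E' : R -> R) :
  a <= m <= b ->
  (forall t, a <= t <= b -> is_derive E t (E' t)) ->
  (forall t, a <= t <= b -> Rabs (E' t) <= K * Rabs (t - m) ^ p) ->
  E m = 0 ->
  forall t, a <= t <= b -> Rabs (E t) <= K * Rabs (t - m) ^ S p.
Proof.
  intros Hm HE HE' H0 t Ht.
  assert (Hin : forall c, Rmin m t <= c <= Rmax m t -> a <= c <= b).
  { intros c; unfold Rmin, Rmax; destruct Rle_dec; lra. }
  destruct (MVT_gen E m t E') as [c [Hc Ec]].
  { intros c Hc; apply HE, Hin; lra. }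
  { intros c Hc; apply continuity_pt_filterlim.
    apply (ex_derive_continuous E); exists (E' c); now apply HE, Hin. }
  rewrite H0, Rminus_0_r in Ec; rewrite Ec, Rabs_mult; simpl.
  replace (K * (Rabs (t - m) * Rabs (t - m) ^ p))
    with (K * Rabs (t - m) ^ p * Rabs (t - m)) by ring.
  apply Rmult_le_compat_r; [apply Rabs_pos |].
  assert (HK : 0 <= K * Rabs (c - m) ^ p).
  { eapply Rle_trans; [apply Rabs_pos | apply HE', Hin, Hc]. }
  eapply Rle_trans; [apply HE', Hin, Hc |].
  assert (Hcm : Rabs (c - m) <= Rabs (t - m)).
  { revert Hc; unfold Rmin, Rmax, Rabs.
    destruct Rle_dec; repeat destruct Rcase_abs; lra. }
  assert (Hp : Rabs (c - m) ^ p <= Rabs (t - m) ^ p).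
  { apply pow_incr; split; [apply Rabs_pos | exact Hcm]. }
  assert (0 <= Rabs (c - m) ^ p) by apply pow_le, Rabs_pos.
  destruct (Rle_lt_dec 0 K) as [HK0 | HK0].
  - apply Rmult_le_compat_l; assumption.
  -
    (* For [K < 0] the hypothesis on [E'] at [t] itself forces the power to vanish. *)
    assert (Ht' := Rle_trans _ _ _ (Rabs_pos _) (HE' t Ht)).
    nra.
Qed.

(** An abstract sequence of successive derivatives, so that the same estimates
    serve [f] along either axis and finite differences of [f]. *)
Definition derivative_chain (G : nat -> R -> R) (a b : R) (p : nat) : Prop :=
  forall (i : nat) (t : R), (i < p)%nat -> a <= t <= b ->
    is_derive (G i) t (G (S i) t).

Lemma derivative_chain_tail (G : nat -> R -> R) (a b : R) (p : nat) :
  derivative_chain G a b (S p) -> derivative_chain (fun i => G (S i)) a b p.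
Proof. intros H i t Hi; apply H; lia. Qed.

Lemma taylor_order1 (G : nat -> R -> R) (a b m K : R) :
  a <= m <= b ->
  derivative_chain G a b 1 ->
  (forall t, a <= t <= b -> Rabs (G 1%nat t) <= K) ->
  forall t, a <= t <= b -> Rabs (G 0%nat t - G 0%nat m) <= K * Rabs (t - m).
Proof.
  intros Hm HG HK t Ht.
  replace (Rabs (t - m)) with (Rabs (t - m) ^ 1) by ring.
  apply (mean_value_growth a b m K 0 (fun t => G 0%nat t - G 0%nat m) (G 1%nat));
    try assumption.
  - intros u Hu.
    replace (G 1%nat u) with (G 1%nat u - 0) by ring.
    apply (is_derive_minus (G 0%nat) (fun _ => G 0%nat m));
      [apply HG; [lia | exact Hu] |].
    apply (is_derive_const (K := R_AbsRing) (V := R_NormedModule)).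
  - intros u Hu; rewrite pow_O, Rmult_1_r; now apply HK.
  - ring.
Qed.

Lemma taylor_order2 (G : nat -> R -> R) (a b m K : R) :
  a <= m <= b ->
  derivative_chain G a b 2 ->
  (forall t, a <= t <= b -> Rabs (G 2%nat t) <= K) ->
  forall t, a <= t <= b ->
    Rabs (G 0%nat t - G 0%nat m - (t - m) * G 1%nat m) <= K * Rabs (t - m) ^ 2.
Proof.
  intros Hm HG HK.
  apply (mean_value_growth a b m K 1
           (fun t => G 0%nat t - G 0%nat m - (t - m) * G 1%nat m)
           (fun t => G 1%nat t - G 1%nat m)); try assumption.
  - intros u Hu.
    pose proof (HG 0%nat u ltac:(lia) Hu) as H0.
    auto_derive; [exists (G 1%nat u); exact H0 |].
    replace (Derive (fun x => G 0%nat x) u) with (G 1%nat u);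
      [ring | symmetry; now apply is_derive_unique].
  - intros u Hu; rewrite pow_1.
    apply (taylor_order1 (fun i => G (S i)) a b m K Hm
             (derivative_chain_tail G a b 1 HG) HK u Hu).
  - ring.
Qed.

Lemma taylor_order3 (G : nat -> R -> R) (a b m K : R) :
  a <= m <= b ->
  derivative_chain G a b 3 ->
  (forall t, a <= t <= b -> Rabs (G 3%nat t) <= K) ->
  forall t, a <= t <= b ->
    Rabs (G 0%nat t - G 0%nat m - (t - m) * G 1%nat m
          - (t - m) ^ 2 / 2 * G 2%nat m) <= K * Rabs (t - m) ^ 3.
Proof.
  intros Hm HG HK.
  apply (mean_value_growth a b m K 2
           (fun t => G 0%nat t - G 0%nat m - (t - m) * G 1%nat m
                     - (t - m) ^ 2 / 2 * G 2%nat m)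
           (fun t => G 1%nat t - G 1%nat m - (t - m) * G 2%nat m));
    try assumption.
  - intros u Hu.
    pose proof (HG 0%nat u ltac:(lia) Hu) as H0.
    auto_derive; [exists (G 1%nat u); exact H0 |].
    replace (Derive (fun x => G 0%nat x) u) with (G 1%nat u);
      [field | symmetry; now apply is_derive_unique].
  - intros u Hu.
    apply (taylor_order2 (fun i => G (S i)) a b m K Hm
             (derivative_chain_tail G a b 2 HG) HK u Hu).
  - field.
Qed.

(** * Three-point difference stencils *)

(** The values of [g] at the nodes [m - r], [m], [m + r] combined into the
    coefficients of the interpolating quadratic in the variable
    [(t - m) / r]: the middle value and the halved central differences of
    orders 1 and 2. *)
Definition stencil (k : nat) (m r : R) (g : R -> R) : R :=
  match k with
  | O => g m
  | 1%nat => (g (m + r) - g (m - r)) / 2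
  | _ => (g (m + r) - 2 * g m + g (m - r)) / 2
  end.

Definition quad_interp (m r : R) (g : R -> R) (t : R) : R :=
  stencil 0 m r g + (t - m) / r * stencil 1 m r g
  + ((t - m) / r) ^ 2 * stencil 2 m r g.

Lemma stencil_ext (k : nat) (m r : R) (g h : R -> R) :
  g (m - r) = h (m - r) -> g m = h m -> g (m + r) = h (m + r) ->
  stencil k m r g = stencil k m r h.
Proof.
  intros H1 H2 H3; destruct k as [|[|k]]; simpl; now rewrite ?H1, ?H2, ?H3.
Qed.

Lemma stencil_abs (k : nat) (m r M : R) (g : R -> R) :
  Rabs (g (m - r)) <= M -> Rabs (g m) <= M -> Rabs (g (m + r)) <= M ->
  Rabs (stencil k m r g) <= 2 * M.
Proof.
  intros H1 H2 H3; apply Rabs_le_between in H1, H2, H3.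
  apply Rabs_le_between; destruct k as [|[|k]]; simpl; lra.
Qed.

Lemma stencil_swap (i j : nat) (m r m' r' : R) (g : R -> R -> R) :
  stencil i m r (fun x => stencil j m' r' (fun y => g x y)) =
  stencil j m' r' (fun y => stencil i m r (fun x => g x y)).
Proof. destruct i as [|[|i]], j as [|[|j]]; simpl; field. Qed.

Lemma stencil_scal (k : nat) (m r c : R) (g : R -> R) :
  stencil k m r (fun t => c * g t) = c * stencil k m r g.
Proof. destruct k as [|[|k]]; simpl; field. Qed.

Lemma stencil_is_derive (k : nat) (m r : R) (g g' : R -> R -> R) (y : R) :
  (forall x, x = m - r \/ x = m \/ x = m + r ->
     is_derive (g x) y (g' x y)) ->
  is_derive (fun y => stencil k m r (fun x => g x y)) y
    (stencil k m r (fun x => g' x y)).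
Proof.
  intros H.
  pose proof (H (m - r) ltac:(auto)) as H1.
  pose proof (H m ltac:(auto)) as H2.
  pose proof (H (m + r) ltac:(auto)) as H3.
  assert (E1 : Derive (fun z => g (m - r) z) y = _) by exact (is_derive_unique _ _ _ H1).
  assert (E2 : Derive (fun z => g (m) z) y = _) by exact (is_derive_unique _ _ _ H2).
  assert (E3 : Derive (fun z => g (m + r) z) y = _) by exact (is_derive_unique _ _ _ H3).
  destruct k as [|[|k]]; simpl; [exact H2 | |].
  all: auto_derive; [repeat split; eexists; eassumption |].
  all: unfold Rminus in *; rewrite ?E1, ?E2, ?E3; field.
Qed.

(** A stencil of order [k] annihilates polynomials of degree less than [k],
    hence the Taylor polynomial of degree [i - 1] of [g] at [m] whenever
    [i <= k]; only the remainder of order [i] is left. *)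
Lemma stencil_order (G : nat -> R -> R) (i k : nat) (m r K : R) :
  0 < r -> (1 <= i)%nat -> (i <= k)%nat -> (k <= 2)%nat ->
  derivative_chain G (m - r) (m + r) i ->
  (forall t, m - r <= t <= m + r -> Rabs (G i t) <= K) ->
  Rabs (stencil k m r (G 0%nat)) <= K * r ^ i.
Proof.
  intros Hr Hi Hik Hk HG HK.
  assert (Hm : m - r <= m <= m + r) by lra.
  assert (Ep : Rabs (m + r - m) = r) by (rewrite Rabs_pos_eq; lra).
  assert (En : Rabs (m - r - m) = r)
    by (rewrite Rabs_left1; lra).
  destruct i as [|[|[|i]]]; try lia.
  - pose proof (taylor_order1 G (m - r) (m + r) m K Hm HG HK) as T.
    pose proof (T (m + r) ltac:(lra)) as T1; rewrite Ep in T1.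
    pose proof (T (m - r) ltac:(lra)) as T2; rewrite En in T2.
    apply Rabs_le_between in T1, T2; apply Rabs_le_between.
    destruct k as [|[|[|k]]]; try lia; simpl; lra.
  - destruct k as [|[|[|k]]]; try lia.
    pose proof (taylor_order2 G (m - r) (m + r) m K Hm HG HK) as T.
    pose proof (T (m + r) ltac:(lra)) as T1; rewrite Ep in T1.
    pose proof (T (m - r) ltac:(lra)) as T2; rewrite En in T2.
    apply Rabs_le_between in T1, T2; apply Rabs_le_between.
    unfold stencil; lra.
Qed.

Lemma unit_offset (m r t : R) :
  0 < r -> m - r <= t <= m + r -> -1 <= (t - m) / r <= 1.
Proof.
  intros Hr Ht.
  split; apply (Rmult_le_reg_r r); try assumption;
    unfold Rdiv; rewrite Rmult_assoc, Rinv_l; lra.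
Qed.

Lemma quad_interp_abs (m r M t : R) (g : R -> R) :
  0 < r -> m - r <= t <= m + r ->
  Rabs (g (m - r)) <= M -> Rabs (g m) <= M -> Rabs (g (m + r)) <= M ->
  Rabs (quad_interp m r g t) <= 3 * M.
Proof.
  intros Hr Ht H1 H2 H3; unfold quad_interp, stencil.
  pose proof (unit_offset m r t Hr Ht) as Hs.
  set (s := (t - m) / r) in *.
  apply Rabs_le_between in H1, H2, H3; apply Rabs_le_between.
  assert (0 <= s ^ 2 <= 1) by (split; nra).
  set (q := s ^ 2) in *.
  split; nra.
Qed.

(** Interpolation is linear and reproduces the second degree Taylor polynomial
    at [m], so the error is that of interpolating the remainder [e], which is
    of size [K * r ^ 3]. *)
Lemma quad_interp_error (G : nat -> R -> R) (m r K t : R) :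
  0 < r -> m - r <= t <= m + r ->
  derivative_chain G (m - r) (m + r) 3 ->
  (forall u, m - r <= u <= m + r -> Rabs (G 3%nat u) <= K) ->
  Rabs (G 0%nat t - quad_interp m r (G 0%nat) t) <= 4 * K * r ^ 3.
Proof.
  intros Hr Ht HG HK.
  assert (Hm : m - r <= m <= m + r) by lra.
  assert (HK0 : 0 <= K) by (eapply Rle_trans; [apply Rabs_pos | now apply (HK m)]).
  set (e u := G 0%nat u - G 0%nat m - (u - m) * G 1%nat m
              - (u - m) ^ 2 / 2 * G 2%nat m).
  assert (He : forall u, m - r <= u <= m + r -> Rabs (e u) <= K * r ^ 3).
  { intros u Hu.
    eapply Rle_trans; [exact (taylor_order3 G _ _ m K Hm HG HK u Hu) |].
    apply Rmult_le_compat_l; [exact HK0 |].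
    apply pow_incr; split; [apply Rabs_pos |].
    apply Rabs_le_between; lra. }
  replace (G 0%nat t - quad_interp m r (G 0%nat) t) with (e t - quad_interp m r e t)
    by (unfold e, quad_interp, stencil; field; lra).
  pose proof (He t Ht) as H1.
  pose proof (quad_interp_abs m r (K * r ^ 3) t e Hr Ht
                (He (m - r) ltac:(lra)) (He m Hm)
                (He (m + r) ltac:(lra))) as H2.
  apply Rabs_le_between in H1, H2; apply Rabs_le_between; lra.
Qed.

(** * The Lagrange interpolant in stencil form *)

(** The coefficient of [((x - m_x) / r_x) ^ a * ((y - m_y) / r_y) ^ b] in the
    biquadratic interpolant of [g]. *)
Definition grid_coef (g : R -> R -> R) (B : box) (a b : nat) : R :=
  stencil a (mid_x B) (rad_x B)
    (fun x => stencil b (mid_y B) (rad_y B) (fun y => g x y)).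

Lemma derive_quadratic (A0 A1 A2 m r : R) (q : R -> R) (k : nat) :
  (forall t, q t = A0 + A1 * t + A2 * t ^ 2) -> (k <= 2)%nat ->
  Derive_n q k m * r ^ k = INR (fact k) * stencil k m r q.
Proof.
  intros Hq Hk.
  assert (D1 : forall t, Derive q t = A1 + 2 * A2 * t).
  { intros t; rewrite (Derive_ext _ _ t Hq).
    apply is_derive_unique; auto_derive; [exact I | ring]. }
  assert (D2 : forall t, Derive (Derive q) t = 2 * A2).
  { intros t; rewrite (Derive_ext _ _ t D1).
    apply is_derive_unique; auto_derive; [exact I | ring]. }
  destruct k as [|[|[|k]]]; try lia.
  - simpl; ring.
  - change (Derive_n q 1 m) with (Derive q m); rewrite D1.
    unfold stencil; rewrite !Hq; simpl; field.
  - change (Derive_n q 2 m) with (Derive (Derive q) m); rewrite D2.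
    unfold stencil; rewrite !Hq; simpl; field.
Qed.

Lemma sum_n_2 (h : nat -> R) : sum_n h 2 = h 0%nat + h 1%nat + h 2%nat.
Proof. now rewrite !sum_Sn, sum_O. Qed.

(** Three nodes determine a quadratic, so its derivatives at the middle node
    are exact difference quotients; for a biquadratic this applies in [y] for
    each fixed [x], and then in [x] since the result is again quadratic. *)
Lemma derive_biquadratic (p : R -> R -> R) (B : box) (a b : nat) :
  biquadratic p -> 0 < rad_x B -> 0 < rad_y B -> (a <= 2)%nat -> (b <= 2)%nat ->
  partial_derive a b p (mid_x B) (mid_y B) =
  INR (fact a) * INR (fact b) * grid_coef p B a b / (rad_x B ^ a * rad_y B ^ b).
Proof.
  intros [c Hc] Hx Hy Ha Hb.
  assert (Hxa := pow_lt _ a Hx); assert (Hyb := pow_lt _ b Hy).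
  set (row x := stencil b (mid_y B) (rad_y B) (p x)).
  pose (col i := stencil b (mid_y B) (rad_y B)
                   (fun y => c i 0%nat + c i 1%nat * y + c i 2%nat * y ^ 2)).
  assert (Hrow : forall x, row x = col 0%nat + col 1%nat * x + col 2%nat * x ^ 2).
  { intros x; unfold row, col.
    destruct b as [|[|b]]; unfold stencil; rewrite !Hc;
      rewrite !sum_n_2; simpl; field. }
  set (w := INR (fact b) / rad_y B ^ b).
  assert (Hin : forall x, Derive_n (p x) b (mid_y B) = w * row x).
  { intros x.
    assert (E := derive_quadratic
              (c 0%nat 0%nat + c 1%nat 0%nat * x + c 2%nat 0%nat * x ^ 2)
              (c 0%nat 1%nat + c 1%nat 1%nat * x + c 2%nat 1%nat * x ^ 2)
              (c 0%nat 2%nat + c 1%nat 2%nat * x + c 2%nat 2%nat * x ^ 2)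
              (mid_y B) (rad_y B) (p x) b).
    unfold w, row.
    apply (Rmult_eq_reg_r (rad_y B ^ b)); [|lra].
    rewrite E; [field; lra | | exact Hb].
    intros y; rewrite Hc, !sum_n_2; simpl; ring. }
  unfold partial_derive.
  change (fun t : R => Derive_n (fun z : R => p t z) b (mid_y B))
    with (fun t : R => Derive_n (p t) b (mid_y B)).
  rewrite (Derive_n_ext _ _ a (mid_x B) Hin).
  assert (E := derive_quadratic (w * col 0%nat) (w * col 1%nat) (w * col 2%nat)
                 (mid_x B) (rad_x B) (fun x => w * row x) a).
  rewrite stencil_scal in E.
  apply (Rmult_eq_reg_r (rad_x B ^ a)); [|lra].
  rewrite E; [| intros x; rewrite Hrow; ring | exact Ha].
  unfold grid_coef.
  change (fun x : R => stencil b (mid_y B) (rad_y B) (fun y : R => p x y)) with row.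
  unfold w; field; lra.
Qed.

(** The tensor product of the one-variable interpolations witnesses the
    existence of the interpolant. *)
Lemma lagrange_spec (g : R -> R -> R) (B : box) :
  0 < rad_x B -> 0 < rad_y B ->
  biquadratic (lagrange g B) /\ interpolates_on_grid g B (lagrange g B).
Proof.
  intros Hx Hy.
  unfold lagrange; apply epsilon_spec.
  exists (fun x y => quad_interp (mid_y B) (rad_y B)
                 (fun y => quad_interp (mid_x B) (rad_x B) (fun x => g x y) x) y).
  split.
  -
    (* [coef m r h k] is the coefficient of [t ^ k] in [quad_interp m r h t]:
       [biquadratic] asks for monomials centred at the origin. *)
    pose (coef m r h k := match k with
      | O => stencil 0 m r h - m / r * stencil 1 m r h
             + (m / r) ^ 2 * stencil 2 m r h
      | 1%nat => stencil 1 m r h / r - 2 * m / r ^ 2 * stencil 2 m r h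
      | _ => stencil 2 m r h / r ^ 2
      end).
    exists (fun a b => coef (mid_y B) (rad_y B)
              (fun y => coef (mid_x B) (rad_x B) (fun x => g x y) a) b).
    intros x y; rewrite !sum_n_2; unfold coef, quad_interp, stencil; simpl.
    field; lra.
  - intros x y Hx' Hy'.
    assert (E : forall m r h t, 0 < r ->
              t = m - r \/ t = m \/ t = m + r -> quad_interp m r h t = h t).
    { intros m r h t Hr [-> | [-> | ->]]; unfold quad_interp, stencil; field; lra. }
    rewrite E; [now rewrite E | assumption | assumption].
Qed.

Lemma grid_coef_lagrange (g : R -> R -> R) (B : box) (a b : nat) :
  0 < rad_x B -> 0 < rad_y B ->
  grid_coef (lagrange g B) B a b = grid_coef g B a b.
Proof.
  intros Hx Hy; destruct (lagrange_spec g B Hx Hy) as [_ H].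
  unfold grid_coef; apply stencil_ext; apply stencil_ext; apply H; auto.
Qed.

(** Both parts depend on [g] only through its nine grid values; powers of the
    radii cancel against those of the difference quotients. *)
Lemma T_part_lagrange (g : R -> R -> R) (B : box) (x y : R) :
  0 < rad_x B -> 0 < rad_y B ->
  let s := (x - mid_x B) / rad_x B in
  let t := (y - mid_y B) / rad_y B in
  T_part (lagrange g B) B x y =
    grid_coef g B 0 0 + s * grid_coef g B 1 0 + t * grid_coef g B 0 1
    + s ^ 2 * grid_coef g B 2 0 + s * t * grid_coef g B 1 1
    + t ^ 2 * grid_coef g B 0 2.
Proof.
  intros Hx Hy s t; destruct (lagrange_spec g B Hx Hy) as [Hb _].
  unfold T_part.
  change (lagrange g B (mid_x B) (mid_y B))
    with (grid_coef (lagrange g B) B 0 0).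
  rewrite !derive_biquadratic by (assumption || lia).
  rewrite !grid_coef_lagrange by assumption.
  unfold s, t; simpl; field; lra.
Qed.

Lemma R_part_lagrange (g : R -> R -> R) (B : box) (x y : R) :
  0 < rad_x B -> 0 < rad_y B ->
  let s := (x - mid_x B) / rad_x B in
  let t := (y - mid_y B) / rad_y B in
  R_part (lagrange g B) B x y =
    s ^ 2 * t * grid_coef g B 2 1 + s * t ^ 2 * grid_coef g B 1 2
    + s ^ 2 * t ^ 2 * grid_coef g B 2 2.
Proof.
  intros Hx Hy s t; destruct (lagrange_spec g B Hx Hy) as [Hb _].
  unfold R_part.
  rewrite !derive_biquadratic by (assumption || lia).
  rewrite !grid_coef_lagrange by assumption.
  unfold s, t; simpl; field; lra.
Qed.

(** * Size of the two parts of the interpolant *)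

Lemma in_box_mid (B : box) (x y : R) :
  in_box x y B <->
  mid_x B - rad_x B <= x <= mid_x B + rad_x B /\
  mid_y B - rad_y B <= y <= mid_y B + rad_y B.
Proof. unfold in_box, mid_x, mid_y, rad_x, rad_y; split; intros; lra. Qed.

Lemma grid_coef_abs (g : R -> R -> R) (B : box) (M : R) (a b : nat) :
  (forall x y, in_box x y B -> Rabs (g x y) <= M) ->
  Rabs (grid_coef g B a b) <= 4 * M.
Proof.
  intros HM; pose proof (bx_le B); pose proof (by_le B).
  replace (4 * M) with (2 * (2 * M)) by ring.
  unfold grid_coef; apply stencil_abs; apply stencil_abs; apply HM;
    apply in_box_mid; unfold rad_x, rad_y; lra.
Qed.

Lemma lipschitz_T_part (L : R -> R -> R) (B : box) :
  lipschitz_on B (T_part L B).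
Proof.
  change (lipschitz_on B (fun x y => T_part L B x y)).
  unfold T_part, Rminus; cbv zeta; cbn [pow].
  repeat first [ apply lipschitz_const | apply lipschitz_x | apply lipschitz_y
               | apply lipschitz_plus | apply lipschitz_mult ].
Qed.

Lemma lipschitz_R_part (L : R -> R -> R) (B : box) :
  lipschitz_on B (R_part L B).
Proof.
  change (lipschitz_on B (fun x y => R_part L B x y)).
  unfold R_part, Rminus; cbv zeta; cbn [pow].
  repeat first [ apply lipschitz_const | apply lipschitz_x | apply lipschitz_y
               | apply lipschitz_plus | apply lipschitz_mult ].
Qed.

Lemma Rabs_scaled_le (s c M : R) : -1 <= s <= 1 -> Rabs c <= M -> Rabs (s * c) <= M.
Proof.
  intros Hs Hc; rewrite Rabs_mult.
  apply Rabs_le_between in Hs.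
  pose proof (Rabs_pos s); pose proof (Rabs_pos c); nra.
Qed.

Lemma unit_sq (s : R) : -1 <= s <= 1 -> -1 <= s ^ 2 <= 1.
Proof. intros; split; nra. Qed.

Lemma unit_mult (s t : R) : -1 <= s <= 1 -> -1 <= t <= 1 -> -1 <= s * t <= 1.
Proof. intros; split; nra. Qed.

Lemma T_part_abs (g : R -> R -> R) (B : box) (M : R) :
  0 < rad_x B -> 0 < rad_y B ->
  (forall x y, in_box x y B -> Rabs (g x y) <= M) ->
  forall x y, in_box x y B -> Rabs (T_part (lagrange g B) B x y) <= 24 * M.
Proof.
  intros Hx Hy HM x y [Ix Iy]%in_box_mid.
  rewrite T_part_lagrange by assumption.
  pose proof (unit_offset _ _ _ Hx Ix) as Hs.
  pose proof (unit_offset _ _ _ Hy Iy) as Ht.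
  set (s := (x - mid_x B) / rad_x B) in *.
  set (t := (y - mid_y B) / rad_y B) in *.
  cbv zeta.
  assert (HE : forall a b, Rabs (grid_coef g B a b) <= 4 * M)
    by (intros; now apply grid_coef_abs).
  pose proof (HE 0%nat 0%nat) as E00.
  pose proof (Rabs_scaled_le s _ _ Hs (HE 1%nat 0%nat)) as E10.
  pose proof (Rabs_scaled_le t _ _ Ht (HE 0%nat 1%nat)) as E01.
  pose proof (Rabs_scaled_le _ _ _ (unit_sq s Hs) (HE 2%nat 0%nat)) as E20.
  pose proof (Rabs_scaled_le _ _ _ (unit_mult s t Hs Ht) (HE 1%nat 1%nat)) as E11.
  pose proof (Rabs_scaled_le _ _ _ (unit_sq t Ht) (HE 0%nat 2%nat)) as E02.
  apply Rabs_le_between in E00, E10, E01, E20, E11, E02.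
  apply Rabs_le_between; lra.
Qed.

Lemma R_part_abs (g : R -> R -> R) (B : box) (M : R) :
  0 < rad_x B -> 0 < rad_y B ->
  Rabs (grid_coef g B 2 1) <= M -> Rabs (grid_coef g B 1 2) <= M ->
  Rabs (grid_coef g B 2 2) <= M ->
  forall x y, in_box x y B -> Rabs (R_part (lagrange g B) B x y) <= 3 * M.
Proof.
  intros Hx Hy H21 H12 H22 x y [Ix Iy]%in_box_mid.
  rewrite R_part_lagrange by assumption.
  pose proof (unit_offset _ _ _ Hx Ix) as Hs.
  pose proof (unit_offset _ _ _ Hy Iy) as Ht.
  set (s := (x - mid_x B) / rad_x B) in *.
  set (t := (y - mid_y B) / rad_y B) in *.
  cbv zeta.
  pose proof (unit_sq s Hs) as Hs2; pose proof (unit_sq t Ht) as Ht2.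
  pose proof (Rabs_scaled_le _ _ _ (unit_mult _ _ Hs2 Ht) H21) as E21.
  pose proof (Rabs_scaled_le _ _ _ (unit_mult _ _ Hs Ht2) H12) as E12.
  pose proof (Rabs_scaled_le _ _ _ (unit_mult _ _ Hs2 Ht2) H22) as E22.
  apply Rabs_le_between in E21, E12, E22.
  apply Rabs_le_between; lra.
Qed.

Lemma itv_mag_le (I : interval) (M : R) :
  Rabs (lo I) <= M -> Rabs (hi I) <= M -> itv_mag I <= M.
Proof. intros; now apply Rmax_lub. Qed.

Lemma itv_mag_abs (I : interval) : Rabs (itv_mag I) = itv_mag I.
Proof.
  apply Rabs_pos_eq; unfold itv_mag.
  eapply Rle_trans; [apply Rabs_pos | apply Rmax_l].
Qed.

(** * Orders of magnitude in the radius *)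

Definition inner_square (B0 B : box) : Prop :=
  is_square B /\ 0 < rad_x B /\ sub_box B B0.

(** A common order calculus for the finitely many quantities that make up the
    remainder, uniform over the squares inside [B0]. *)
Definition is_O (B0 : box) (p : nat) (phi : box -> R) : Prop :=
  exists C : R, 0 <= C /\
    forall B, inner_square B0 B -> Rabs (phi B) <= C * rad_x B ^ p.

Lemma is_O_const (B0 : box) (c : R) : is_O B0 0 (fun _ => c).
Proof. exists (Rabs c); split; [apply Rabs_pos |]; intros; simpl; lra. Qed.

Lemma is_O_rad (B0 : box) : is_O B0 1 rad_x.
Proof.
  exists 1; split; [lra |]; intros B [_ [Hr _]].
  rewrite Rabs_pos_eq; lra.
Qed.

Lemma is_O_plus (B0 : box) (p : nat) (phi psi : box -> R) :
  is_O B0 p phi -> is_O B0 p psi -> is_O B0 p (fun B => phi B + psi B).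
Proof.
  intros [C [HC H1]] [D [HD H2]]; exists (C + D); split; [lra |].
  intros B HB; specialize (H1 B HB); specialize (H2 B HB).
  eapply Rle_trans; [apply Rabs_triang | lra].
Qed.

Lemma is_O_mult (B0 : box) (p q : nat) (phi psi : box -> R) :
  is_O B0 p phi -> is_O B0 q psi -> is_O B0 (p + q) (fun B => phi B * psi B).
Proof.
  intros [C [HC H1]] [D [HD H2]]; exists (C * D); split; [nra |].
  intros B HB; rewrite Rabs_mult, pow_add.
  replace (C * D * (rad_x B ^ p * rad_x B ^ q))
    with (C * rad_x B ^ p * (D * rad_x B ^ q)) by ring.
  apply Rmult_le_compat; auto using Rabs_pos.
Qed.

Lemma is_O_pow (B0 : box) (p k : nat) (phi : box -> R) :
  is_O B0 p phi -> is_O B0 (k * p) (fun B => phi B ^ k).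
Proof.
  intros H; induction k as [|k IH]; simpl.
  - apply is_O_const.
  - now apply is_O_mult.
Qed.

Lemma rad_bounded (B0 B : box) : inner_square B0 B -> rad_x B <= rad_x B0.
Proof.
  intros [_ [_ H]].
  pose proof (bx_le B) as Hx; pose proof (by_le B) as Hy.
  destruct (H (bax B) (bay B)) as [H1 _]; [split; lra |].
  destruct (H (bbx B) (bay B)) as [H2 _]; [split; lra |].
  unfold rad_x; lra.
Qed.

(** The radii of the squares inside [B0] are bounded, so surplus powers of the
    radius can be absorbed into the constant. *)
Lemma is_O_weaken (B0 : box) (p q : nat) (phi : box -> R) :
  (q <= p)%nat -> is_O B0 p phi -> is_O B0 q phi.
Proof.
  intros Hqp [C [HC H]].
  pose proof (bx_le B0) as H0.
  assert (Hr0 : 0 <= rad_x B0) by (unfold rad_x; lra).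
  exists (C * rad_x B0 ^ (p - q)); split.
  { apply Rmult_le_pos; [exact HC | now apply pow_le]. }
  intros B HB; eapply Rle_trans; [now apply H |].
  replace p with ((p - q) + q)%nat at 1 by lia.
  rewrite pow_add, Rmult_assoc.
  apply Rmult_le_compat_l; [exact HC |].
  pose proof (rad_bounded B0 B HB); destruct HB as [_ [Hr _]].
  apply Rmult_le_compat_r; [apply pow_le; lra |].
  apply pow_incr; lra.
Qed.

Lemma is_O_sum (B0 : box) (p a b : nat) (phi : nat -> box -> R) :
  (forall k, (a <= k <= b)%nat -> is_O B0 p (phi k)) ->
  is_O B0 p (fun B => sum_n_m (fun k => phi k B) a b).
Proof.
  assert (Hz : is_O B0 p (fun _ => 0)).
  { exists 0; split; [lra |]; intros; rewrite Rabs_R0; lra. }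
  induction b as [|b IH]; intros H.
  - destruct a as [|a].
    + destruct (H 0%nat ltac:(lia)) as [C [HC H']].
      exists C; split; [exact HC |]; intros; rewrite sum_n_n; auto.
    + destruct Hz as [C [HC H']]; exists C; split; [exact HC |].
      intros; rewrite sum_n_m_zero by lia; now apply H'.
  - destruct (le_lt_dec a (S b)) as [Hab | Hab].
    + assert (E : is_O B0 p (fun B => sum_n_m (fun k => phi k B) a b + phi (S b) B)).
      { apply is_O_plus; [apply IH; intros |]; apply H; lia. }
      destruct E as [C [HC E]]; exists C; split; [exact HC |].
      intros; rewrite sum_n_Sm by lia; now apply E.
    + destruct Hz as [C [HC H']]; exists C; split; [exact HC |].
      intros; rewrite sum_n_m_zero by lia; now apply H'.
Qed.

Lemma is_O_Omega_pow (B0 : box) (k : nat) :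
  (1 <= k)%nat -> is_O B0 3 (fun B => Omega_L B ^ k).
Proof.
  intros Hk; apply (is_O_weaken B0 (k * 3)); [lia |].
  apply is_O_pow; unfold Omega_L.
  apply (is_O_mult B0 0 3); [apply is_O_const |].
  apply (is_O_pow B0 1 3), is_O_rad.
Qed.

(** * Bounds from the derivatives *)

Definition smooth_on (B0 : box) (f : R -> R -> R) (N : nat) : Prop :=
  forall i j : nat, (i + j <= N)%nat ->
    (forall x y : R, in_box x y B0 -> ex_partial i j f x y) /\
    (exists K : R, forall x y : R, in_box x y B0 ->
       Rabs (partial_derive i j f x y) <= K).

Lemma smooth_bound (B0 : box) (f : R -> R -> R) (N i j : nat) :
  smooth_on B0 f N -> (i + j <= N)%nat ->
  exists K, 0 <= K /\ forall x y, in_box x y B0 ->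
    Rabs (partial_derive i j f x y) <= K.
Proof.
  intros H Hij; destruct (H i j Hij) as [_ [K HK]].
  exists (Rmax 0 K); split; [apply Rmax_l |].
  intros; eapply Rle_trans; [now apply HK | apply Rmax_r].
Qed.

Lemma derivative_chain_x (B0 : box) (f : R -> R -> R) (N j p : nat) (a b y : R) :
  smooth_on B0 f N -> (p + j <= N)%nat ->
  (forall x, a <= x <= b -> in_box x y B0) ->
  derivative_chain (fun i x => partial_derive i j f x y) a b p.
Proof.
  intros H Hp Hin i x Hi Hx.
  destruct (H (S i) j ltac:(lia)) as [Hex _].
  destruct (Hex x y (Hin x Hx)) as [_ Hd].
  exact (Derive_correct _ _ Hd).
Qed.

Lemma derivative_chain_y (B0 : box) (f : R -> R -> R) (N p : nat) (a b x : R) :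
  smooth_on B0 f N -> (p <= N)%nat ->
  (forall y, a <= y <= b -> in_box x y B0) ->
  derivative_chain (fun j y => partial_derive 0 j f x y) a b p.
Proof.
  intros H Hp Hin j y Hj Hy.
  destruct (H 0%nat (S j) ltac:(lia)) as [Hex _].
  destruct (Hex x y (Hin y Hy)) as [_ Hd].
  exact (Derive_correct _ _ Hd).
Qed.

Lemma smooth_lipschitz (B0 B : box) (f : R -> R -> R) (N : nat) :
  smooth_on B0 f N -> (1 <= N)%nat -> sub_box B B0 -> lipschitz_on B f.
Proof.
  intros H HN HB.
  destruct (smooth_bound B0 f N 1 0 H HN) as [K [HK Kx]].
  destruct (smooth_bound B0 f N 0 1 H HN) as [M [HM My]].
  exists (K + M); split; [lra |].
  intros x y x' y' [Hx Hy] [Hx' Hy'].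
  assert (Dx : Rabs (f x y - f x' y) <= K * Rabs (x - x')).
  { assert (Hin : forall t, bax B <= t <= bbx B -> in_box t y B0)
      by (intros; apply HB; split; assumption).
    apply (taylor_order1 (fun i x => partial_derive i 0 f x y) (bax B) (bbx B));
      auto.
    apply (derivative_chain_x B0 f N 0 1); [exact H | lia | exact Hin]. }
  assert (Dy : Rabs (f x' y - f x' y') <= M * Rabs (y - y')).
  { assert (Hin : forall t, bay B <= t <= bby B -> in_box x' t B0)
      by (intros; apply HB; split; assumption).
    apply (taylor_order1 (fun j y => partial_derive 0 j f x' y) (bay B) (bby B));
      auto.
    apply (derivative_chain_y B0 f N 1); [exact H | lia | exact Hin]. }
  replace (f x y - f x' y') with ((f x y - f x' y) + (f x' y - f x' y')) by ring.
  eapply Rle_trans; [apply Rabs_triang |].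
  pose proof (Rabs_pos (x - x')); pose proof (Rabs_pos (y - y')); nra.
Qed.

(** The stencil in [x] is taken inside, so that [j] derivatives in [y] fall on
    [f] first and the [i] derivatives in [x] after them, the order of
    differentiation in [partial_derive i j f]. *)
Lemma grid_coef_order (B0 B : box) (f : R -> R -> R) (N i j a b : nat) (K : R) :
  smooth_on B0 f N -> (i + j <= N)%nat ->
  (1 <= i <= a)%nat -> (a <= 2)%nat -> (1 <= j <= b)%nat -> (b <= 2)%nat ->
  (forall x y, in_box x y B0 -> Rabs (partial_derive i j f x y) <= K) ->
  inner_square B0 B ->
  Rabs (grid_coef f B a b) <= K * rad_x B ^ (i + j).
Proof.
  intros H HN Hi Ha Hj Hb HK [Hsq [Hr Hsub]].
  unfold is_square in Hsq.
  assert (Hin : forall x y, mid_x B - rad_x B <= x <= mid_x B + rad_x B ->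
            mid_y B - rad_y B <= y <= mid_y B + rad_y B -> in_box x y B0).
  { intros; apply Hsub, in_box_mid; auto. }
  unfold grid_coef; rewrite stencil_swap, pow_add.
  rewrite <- Hsq in Hin |- *.
  replace (K * (rad_x B ^ i * rad_x B ^ j))
    with (K * rad_x B ^ i * rad_x B ^ j) by ring.
  apply (stencil_order
           (fun j y => stencil a (mid_x B) (rad_x B)
                         (fun x => partial_derive 0 j f x y)) j b); try lia.
  - exact Hr.
  - intros l y Hl Hy; apply stencil_is_derive; intros x Hx.
    apply (derivative_chain_y B0 f N j _ _ x H ltac:(lia)
             (fun y => Hin x y ltac:(lra)) l y Hl Hy).
  - intros y Hy.
    apply (stencil_order (fun i x => partial_derive i j f x y) i a);
      try lia; try exact Hr.
    + apply (derivative_chain_x B0 f N j i); [exact H | lia |].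
      intros x Hx; now apply Hin.
    + intros x Hx; apply HK, Hin; assumption.
Qed.

(** The interpolant is the tensor product of the one-variable interpolations;
    this form reduces its error to one variable at a time. *)
Lemma T_plus_R_quad_interp (g : R -> R -> R) (B : box) (x y : R) :
  0 < rad_x B -> 0 < rad_y B ->
  T_part (lagrange g B) B x y + R_part (lagrange g B) B x y =
  quad_interp (mid_y B) (rad_y B)
    (fun y => quad_interp (mid_x B) (rad_x B) (fun x => g x y) x) y.
Proof.
  intros Hx Hy.
  rewrite T_part_lagrange, R_part_lagrange by assumption; cbv zeta.
  unfold quad_interp, grid_coef.
  set (s := (x - mid_x B) / rad_x B); set (t := (y - mid_y B) / rad_y B).
  unfold stencil; field.
Qed.

(** Each of the three mixed coefficients of the remainder contains a stencil of
    order 2 in one direction and one of order at least 1 in the other, so a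
    derivative of total order 3 controls it; for the coefficient [(2, 2)] the
    derivative [(2, 1)] suffices. *)
Lemma R_part_small (B0 : box) (f : R -> R -> R) (N : nat) :
  smooth_on B0 f N -> (3 <= N)%nat ->
  exists C, 0 <= C /\ forall B, inner_square B0 B -> forall x y, in_box x y B ->
    Rabs (R_part (lagrange f B) B x y) <= C * rad_x B ^ 3.
Proof.
  intros H HN.
  destruct (smooth_bound B0 f N 2 1 H HN) as [K [HK K21]].
  destruct (smooth_bound B0 f N 1 2 H HN) as [M [HM M12]].
  exists (3 * (K + M)); split; [lra |].
  intros B HB x y Hxy.
  pose proof (grid_coef_order B0 B f N 2 1 2 1 K H HN ltac:(lia) ltac:(lia)
                ltac:(lia) ltac:(lia) K21 HB) as E21.
  pose proof (grid_coef_order B0 B f N 2 1 2 2 K H HN ltac:(lia) ltac:(lia)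
                ltac:(lia) ltac:(lia) K21 HB) as E22.
  pose proof (grid_coef_order B0 B f N 1 2 1 2 M H HN ltac:(lia) ltac:(lia)
                ltac:(lia) ltac:(lia) M12 HB) as E12.
  destruct HB as [Hsq [Hr _]]; unfold is_square in Hsq.
  assert (Hr3 : 0 < rad_x B ^ 3) by now apply pow_lt.
  change (2 + 1)%nat with 3%nat in *; change (1 + 2)%nat with 3%nat in *.
  rewrite Rmult_assoc; apply R_part_abs; try assumption; try lra; nra.
Qed.

(** Interpolating along the column through [(x, y)] costs a third derivative in
    [y]; replacing the three column values by interpolants along their rows
    costs a third derivative in [x], amplified at most three times.  This bounds
    the error of the full interpolant, which differs from its Taylor part by
    the small remainder. *)
Lemma T_part_close (B0 : box) (f : R -> R -> R) (N : nat) :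
  smooth_on B0 f N -> (3 <= N)%nat ->
  exists C, 0 <= C /\ forall B, inner_square B0 B -> forall x y, in_box x y B ->
    Rabs (f x y - T_part (lagrange f B) B x y) <= C * rad_x B ^ 3.
Proof.
  intros H HN.
  destruct (R_part_small B0 f N H HN) as [C [HC HR]].
  destruct (smooth_bound B0 f N 3 0 H HN) as [K [HK K30]].
  destruct (smooth_bound B0 f N 0 3 H HN) as [M [HM M03]].
  exists (C + 12 * K + 4 * M); split; [lra |].
  intros B HB x y Hxy; specialize (HR B HB x y Hxy).
  destruct HB as [Hsq [Hr Hsub]]; unfold is_square in Hsq.
  assert (Hry : 0 < rad_y B) by lra.
  pose proof (T_plus_R_quad_interp f B x y Hr Hry) as E.
  assert (Hin : forall x y, mid_x B - rad_x B <= x <= mid_x B + rad_x B ->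
            mid_y B - rad_y B <= y <= mid_y B + rad_y B -> in_box x y B0).
  { intros; apply Hsub, in_box_mid; auto. }
  apply in_box_mid in Hxy; destruct Hxy as [Hx Hy].
  set (row := fun y => quad_interp (mid_x B) (rad_x B) (fun x => f x y) x) in E.
  assert (Ey : Rabs (f x y - quad_interp (mid_y B) (rad_y B) (f x) y)
               <= 4 * M * rad_y B ^ 3).
  { apply (quad_interp_error (fun j y => partial_derive 0 j f x y)); try assumption.
    - apply (derivative_chain_y B0 f N 3); auto.
    - auto. }
  assert (Ex : forall v, mid_y B - rad_y B <= v <= mid_y B + rad_y B ->
            Rabs (f x v - row v) <= 4 * K * rad_x B ^ 3).
  { intros v Hv; unfold row.
    apply (quad_interp_error (fun i x => partial_derive i 0 f x v)); try assumption.
    - apply (derivative_chain_x B0 f N 0 3); auto.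
    - auto. }
  assert (Exy : Rabs (quad_interp (mid_y B) (rad_y B) (fun v => f x v - row v) y)
                <= 3 * (4 * K * rad_x B ^ 3)).
  { apply quad_interp_abs; try assumption; apply Ex; lra. }
  replace (quad_interp (mid_y B) (rad_y B) (fun v => f x v - row v) y)
    with (quad_interp (mid_y B) (rad_y B) (f x) y - quad_interp (mid_y B) (rad_y B) row y)
    in Exy by (unfold quad_interp, stencil; field; lra).
  rewrite <- Hsq in Ey at 2.
  apply Rabs_le_between in HR, Ey, Exy; apply Rabs_le_between; lra.
Qed.

Lemma TR_bounded (B0 : box) (f : R -> R -> R) (N i j : nat) :
  smooth_on B0 f N -> (3 * i + 3 * j <= N)%nat ->
  is_O B0 0 (fun B => itv_mag (TR_itv f B i j)).
Proof.
  intros H Hij.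
  destruct (smooth_bound B0 f N (3 * i) (3 * j) H Hij) as [K [HK HKb]].
  exists (36 * K); split; [lra |].
  intros B [Hsq [Hr Hsub]]; unfold is_square in Hsq.
  assert (Hry : 0 < rad_y B) by lra.
  set (g := partial_derive (3 * i) (3 * j) f) in *.
  assert (Hg : forall x y, in_box x y B -> Rabs (g x y) <= K) by auto.
  destruct (range_itv_abs B _ _ (lipschitz_T_part (lagrange g B) B)
              (T_part_abs g B K Hr Hry Hg)) as [T1 T2].
  assert (HE := fun a b => grid_coef_abs g B K a b Hg).
  destruct (range_itv_abs B _ _ (lipschitz_R_part (lagrange g B) B)
              (R_part_abs g B (4 * K) Hr Hry (HE _ _) (HE _ _) (HE _ _)))
    as [R1 R2].
  rewrite itv_mag_abs; simpl pow; rewrite Rmult_1_r.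
  unfold TR_itv, L_poly; fold g.
  apply itv_mag_le; simpl; eapply Rle_trans; try apply Rabs_triang; lra.
Qed.

Lemma range_function_bounded (B0 : box) (G : box -> interval) :
  bounded_over B0 G -> is_O B0 0 (fun B => itv_mag (G B)).
Proof.
  intros [K HK]; exists (Rmax 0 K); split; [apply Rmax_l |].
  intros B [_ [_ Hsub]]; rewrite itv_mag_abs; simpl; rewrite Rmult_1_r.
  eapply Rle_trans; [now apply HK | apply Rmax_r].
Qed.

(** Every [u_k] is bounded and every power of [Omega_L] that occurs is at least
    the first, hence cubic in the radius. *)
Lemma U_bound_cubic (n : nat) (B0 : box) (f : R -> R -> R)
    (F : nat -> nat -> box -> interval) :
  smooth_on B0 f (3 * n + 3) ->
  (forall i j, (i + j = n)%nat \/ (i + j = n + 1)%nat -> bounded_over B0 (F i j)) ->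
  is_O B0 3 (U_bound n f F).
Proof.
  intros H HF.
  assert (Hterm : forall (c : R) (I : box -> interval),
            is_O B0 0 (fun B => itv_mag (I B)) ->
            is_O B0 0 (fun B => c * itv_mag (I B))).
  { intros c I HI; apply (is_O_mult B0 0 0); [apply is_O_const | exact HI]. }
  apply is_O_sum; intros k Hk.
  apply (is_O_mult B0 0 3); [| apply is_O_Omega_pow; lia].
  unfold u_coef.
  destruct (Nat.ltb_spec k n) as [Hkn | Hkn]; [| destruct (Nat.eqb_spec k n)].
  - apply (is_O_sum B0 0 0 k); intros j Hj.
    apply Hterm, (TR_bounded B0 f (3 * n + 3)); [exact H | lia].
  - apply (is_O_sum B0 0 0 n); intros j Hj.
    apply Hterm, range_function_bounded, HF; lia.
  - apply is_O_sum; intros j Hj.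
    apply Hterm, range_function_bounded, HF; lia.
Qed.

(** * Cubic convergence *)

Theorem theorem4 :
  forall (n : nat) (B0 : box) (f : R -> R -> R)
         (F : nat -> nat -> box -> interval),
    (1 <= n)%nat ->
    (forall i j : nat, (i + j <= 3 * n + 3)%nat ->
       (forall x y : R, in_box x y B0 -> ex_partial i j f x y) /\
       (exists K : R, forall x y : R, in_box x y B0 ->
          Rabs (partial_derive i j f x y) <= K)) ->
    (forall i j : nat, (i + j = n)%nat \/ (i + j = n + 1)%nat ->
       is_range_function (ex_partial (3 * i) (3 * j) f)
         (partial_derive (3 * i) (3 * j) f) (F i j) /\
       bounded_over B0 (F i j)) ->
    exists C : R, 0 < C /\
      forall B : box, is_square B -> 0 < rad_x B -> sub_box B B0 ->
        itv_dH (range_itv f B) (lagrange_form n f F B) <= C * width B ^ 3.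
Proof.
  intros n B0 f F Hn Hf HF.
  destruct (T_part_close B0 f (3 * n + 3) Hf ltac:(lia)) as [CT [HCT HT]].
  destruct (R_part_small B0 f (3 * n + 3) Hf ltac:(lia)) as [CR [HCR HR]].
  destruct (U_bound_cubic n B0 f F Hf (fun i j Hij => proj2 (HF i j Hij)))
    as [CU [HCU HU]].
  exists (CT + CR + CU + 1); split; [lra |].
  intros B Hsq Hr Hsub.
  assert (HB : inner_square B0 B) by exact (conj Hsq (conj Hr Hsub)).
  specialize (HT B HB); specialize (HR B HB); specialize (HU B HB).
  assert (Hw : width B = 2 * rad_x B).
  { unfold width; rewrite <- Hsq, Rmax_left; lra. }
  assert (Hr3 : 0 < rad_x B ^ 3) by now apply pow_lt.
  destruct (range_itv_close B f _ _
              (smooth_lipschitz B0 B f (3 * n + 3) Hf ltac:(lia) Hsub)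
              (lipschitz_T_part (lagrange f B) B) HT) as [T1 T2].
  destruct (range_itv_abs B _ _ (lipschitz_R_part (lagrange f B) B) HR)
    as [R1 R2].
  apply Rle_trans with ((CT + CR + CU) * rad_x B ^ 3).
  2:{ rewrite Hw; replace ((2 * rad_x B) ^ 3) with (8 * rad_x B ^ 3) by ring.
      nra. }
  unfold itv_dH, lagrange_form, TR_itv, L_poly; simpl lo; simpl hi.
  change (partial_derive 0 0 f) with f.
  set (u := U_bound n f F B) in *.
  pose proof (Rle_abs u) as Hu; pose proof (Rabs_maj2 u) as Hu'.
  assert (Hmin : Rabs (Rmin (u * -1) (u * 1)) <= Rabs u).
  { apply Rabs_le_between; unfold Rmin; destruct Rle_dec; lra. }
  assert (Hmax : Rabs (Rmax (u * -1) (u * 1)) <= Rabs u).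
  { apply Rabs_le_between; unfold Rmax; destruct Rle_dec; lra. }
  assert (Hmin' := Rle_trans _ _ _ Hmin HU).
  assert (Hmax' := Rle_trans _ _ _ Hmax HU).
  apply Rabs_le_between in T1, T2, R1, R2, Hmin', Hmax'.
  apply Rmax_lub; apply Rabs_le_between; lra.
Qed.
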